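(* $$\frac{1}{\zeta(7)-4\zeta(3)+4}=\mathrm{CF}\left[n^7+(n+1)^7+8\{n^5+(n+1)^5\}-8\{n^3+(n+1)^3\}+4(2n+1),\,-n^{14}\right].$$
   Context: For sequences $(a_n)_{n\ge0}$, $(b_n)_{n\ge1}$, $\mathrm{CF}[a_n,b_n]$ denotes the continued fraction $a_0+\cfrac{b_1}{a_1+\cfrac{b_2}{a_2+\ddots}}$, whose value is $\lim_{n\to\infty}A_n/B_n$, where $A_0=1$, $A_1=a_0$, $B_0=0$, $B_1=1$, and $A_{n+1}=a_nA_n+b_nA_{n-1}$, $B_{n+1}=a_nB_n+b_nB_{n-1}$ for $n\ge1$. $\zeta$ is the Riemann zeta function. *)

(* Defs.v *)
From Stdlib Require Import Reals.
From Coquelicot Require Import Coquelicot.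
Open Scope R_scope.

(* The Riemann zeta function on its half-line of convergence s > 1; for s <= 1
   the series diverges and the value is meaningless. [Series] starts at n = 0. *)
Definition zeta (s : R) : R := Series (fun n : nat => Rpower (INR (S n)) (- s)).

(* u 0 = u0, u 1 = u1, u (n+1) = a n * u n + b n * u (n-1) for n >= 1.
   In particular b 0 is never used. *)
Fixpoint cf_rec (a b : nat -> R) (u0 u1 : R) (n : nat) {struct n} : R :=
  match n with
  | O => u0
  | S O => u1
  | S (S k as m) => a m * cf_rec a b u0 u1 m + b m * cf_rec a b u0 u1 k
  end.

Definition cf_num (a b : nat -> R) : nat -> R := cf_rec a b 1 (a 0%nat).
Definition cf_den (a b : nat -> R) : nat -> R := cf_rec a b 0 1.

(* The quotients need only be defined from some index on: cf_den a b 0 = 0 always,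
   and division by zero is total here, so nonvanishing is required explicitly. *)
Definition is_CF (a b : nat -> R) (l : R) : Prop :=
  eventually (fun n => cf_den a b n <> 0) /\
  is_lim_seq (fun n => cf_num a b n / cf_den a b n) l.

(* Main.v *)
(** The numerators have the closed form [A_n = n!^7 w_n] with [w_n = 2n^2+2n+1].
    By the determinant formula,
    [B_(n+1)/A_(n+1) - B_n/A_n = n!^14 / (A_n A_(n+1)) = 1 / ((n+1)^7 w_n w_(n+1))],
    and since [w_(m-1) w_m = 4m^4+1] this term, with [m = n+1], is
    [1/m^7 - 4/m^3 + 16m/(4m^4+1) = 1/m^7 - 4/m^3 + 4 (1/w_(m-1) - 1/w_m)].
    Summing, [B_n/A_n] tends to [zeta 7 - 4 zeta 3 + 4]. *)

Require Import Defs.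
From Stdlib Require Import Reals Factorial Lra Lia.
From Coquelicot Require Import Coquelicot.
Open Scope R_scope.

Lemma is_series_telescope (f : nat -> R) (l : R) :
  is_lim_seq f l -> is_series (fun k => f k - f (S k)) (f 0%nat - l).
Proof.
  intros Hf.
  change (is_lim_seq (sum_n (fun k => f k - f (S k))) (f 0%nat - l)).
  apply (is_lim_seq_ext (fun n => f 0%nat - f (S n))).
  - intros n; induction n as [|n IH].
    + now rewrite sum_O.
    + rewrite sum_Sn, <- IH; unfold plus; simpl; ring.
  - apply is_lim_seq_minus'.
    + apply is_lim_seq_const.
    + now apply -> is_lim_seq_incr_1.
Qed.

Lemma is_lim_seq_inv_le (f : nat -> R) :
  (forall n, INR (S n) <= f n) -> is_lim_seq (fun n => / f n) 0.
Proof.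
  intros Hf.
  apply (is_lim_seq_inv f p_infty).
  - apply (is_lim_seq_le_p_loc (fun n => INR (S n))).
    + now exists 0%nat.
    + apply -> (is_lim_seq_incr_1 INR); apply is_lim_seq_INR.
  - discriminate.
Qed.

(** Comparison with a telescoping series: for [x >= 1], [1/x^p <= 1/x^2 <= 2 (1/x - 1/(x+1))]. The
    factor 2 gives equality in the second bound at [x = 1]. *)
Lemma ex_series_inv_pow (p : nat) :
  (2 <= p)%nat -> ex_series (fun n => / INR (S n) ^ p).
Proof.
  intros Hp.
  apply (@ex_series_le R_AbsRing R_CompleteNormedModule _
           (fun n => 2 * (/ INR (S n) - / INR (S (S n))))).
  - intros n.
    assert (Hn : 1 <= INR (S n)) by (rewrite S_INR; pose proof (pos_INR n); lra).
    change (Rabs (/ INR (S n) ^ p) <= 2 * (/ INR (S n) - / INR (S (S n)))).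
    rewrite (S_INR (S n)); set (x := INR (S n)) in *.
    rewrite Rabs_pos_eq by (apply Rlt_le, Rinv_0_lt_compat, pow_lt; lra).
    apply Rle_trans with (/ x ^ 2).
    + apply Rinv_le_contravar; [apply pow_lt; lra | now apply Rle_pow].
    + assert (E : 2 * (/ x - / (x + 1)) - / x ^ 2 = (x - 1) / (x ^ 2 * (x + 1)))
        by (field; lra).
      assert (0 <= (x - 1) / (x ^ 2 * (x + 1))).
      { apply Rdiv_le_0_compat; [lra|].
        apply Rmult_lt_0_compat; [apply pow_lt|]; lra. }
      lra.
  - apply (@ex_series_scal R_AbsRing R_NormedModule 2
             (fun n => / INR (S n) - / INR (S (S n)))).
    exists (/ INR 1 - 0).
    apply (is_series_telescope (fun n => / INR (S n))).
    apply is_lim_seq_inv_le; intros n; lra.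
Qed.

Lemma is_series_zeta (p : nat) :
  (2 <= p)%nat -> is_series (fun n => / INR (S n) ^ p) (zeta (INR p)).
Proof.
  intros Hp; unfold zeta.
  rewrite (Series_ext _ (fun n => / INR (S n) ^ p)).
  - now apply Series_correct, ex_series_inv_pow.
  - intros n; rewrite Rpower_Ropp, Rpower_pow; [reflexivity|].
    apply lt_0_INR; lia.
Qed.

Definition weight (n : nat) : R := 2 * INR n ^ 2 + 2 * INR n + 1.

Definition weight_term (k : nat) : R :=
  / (INR (S k) ^ 7 * (weight k * weight (S k))).

(** This linear bound yields both positivity of [weight] and [/ weight n -> 0]. *)
Lemma weight_ge (n : nat) : INR (S n) <= weight n.
Proof.
  unfold weight; rewrite S_INR; pose proof (pos_INR n); nra.
Qed.

Lemma weight_pos (n : nat) : 0 < weight n.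
Proof.
  apply Rlt_le_trans with (2 := weight_ge n), lt_0_INR; lia.
Qed.

Lemma is_series_weight_term :
  is_series weight_term (zeta 7 - 4 * zeta 3 + 4).
Proof.
  pose proof (is_series_zeta 7 ltac:(lia)) as H7.
  pose proof (is_series_zeta 3 ltac:(lia)) as H3.
  replace (INR 7) with 7 in H7 by (simpl; ring).
  replace (INR 3) with 3 in H3 by (simpl; ring).
  (* Since [weight 0 = 1], four times this sum is the constant 4 of the limit. *)
  assert (Hw : is_series (fun k => / weight k - / weight (S k)) (/ weight 0 - 0)).
  { apply (is_series_telescope (fun n => / weight n)).
    apply is_lim_seq_inv_le, weight_ge. }
  pose proof (is_series_plus _ _ _ _
    (is_series_plus _ _ _ _ H7 (is_series_scal (-4) _ _ H3))
    (is_series_scal 4 _ _ Hw)) as H.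
  replace (zeta 7 - 4 * zeta 3 + 4) with
    (plus (plus (zeta 7) (-4 * zeta 3)) (4 * (/ weight 0 - 0))).
  - revert H; apply is_series_ext; intros k.
    pose proof (weight_pos k); pose proof (weight_pos (S k)).
    change (/ INR (S k) ^ 7 + -4 * / INR (S k) ^ 3
            + 4 * (/ weight k - / weight (S k)) = weight_term k).
    unfold weight_term, weight in *; rewrite !S_INR in *; pose proof (pos_INR k).
    set (x := INR k) in *; field; repeat split; nra.
  - unfold plus, weight; simpl; field.
Qed.

Definition coef_a (n : nat) : R :=
  INR n ^ 7 + (INR n + 1) ^ 7
  + 8 * (INR n ^ 5 + (INR n + 1) ^ 5)
  - 8 * (INR n ^ 3 + (INR n + 1) ^ 3)
  + 4 * (2 * INR n + 1).

Definition coef_b (n : nat) : R := - INR n ^ 14.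

Lemma cf_rec_SS (a b : nat -> R) (u0 u1 : R) (n : nat) :
  cf_rec a b u0 u1 (S (S n)) =
  a (S n) * cf_rec a b u0 u1 (S n) + b (S n) * cf_rec a b u0 u1 n.
Proof. reflexivity. Qed.

Lemma INR_fact_S (n : nat) : INR (fact (S n)) = INR (S n) * INR (fact n).
Proof. now rewrite fact_simpl, mult_INR. Qed.

Lemma sum_n_Rplus (f : nat -> R) (n : nat) : sum_n f (S n) = sum_n f n + f (S n).
Proof. exact (sum_Sn f n). Qed.

(** After division by [n!^7] the recurrence becomes the polynomial identity
    [a_n w_n = (n+1)^7 w_(n+1) + n^7 w_(n-1)]. *)
Lemma cf_num_closed (n : nat) :
  cf_num coef_a coef_b n = INR (fact n) ^ 7 * weight n.
Proof.
  unfold cf_num.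
  (* The recurrence has order two, so the induction carries two consecutive values. *)
  enough (H : cf_rec coef_a coef_b 1 (coef_a 0) n = INR (fact n) ^ 7 * weight n /\
    cf_rec coef_a coef_b 1 (coef_a 0) (S n) = INR (fact (S n)) ^ 7 * weight (S n))
    by apply H.
  induction n as [|n [IH0 IH1]].
  - unfold coef_a, weight; simpl; split; ring.
  - split; [exact IH1|].
    rewrite cf_rec_SS, IH0, IH1, !INR_fact_S.
    unfold coef_a, coef_b, weight; rewrite !S_INR; ring.
Qed.

(** [B_(n+1)/A_(n+1)] is the sum of the increments [weight_term 0] to [weight_term n]. The index
    starts at 1 because [sum_n] always includes the term 0, whereas [B_0/A_0 = 0] is the empty
    sum. *)
Lemma cf_den_closed (n : nat) :
  cf_den coef_a coef_b (S n) =
  INR (fact (S n)) ^ 7 * weight (S n) * sum_n weight_term n.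
Proof.
  unfold cf_den.
  enough (H :
    cf_rec coef_a coef_b 0 1 (S n) =
      INR (fact (S n)) ^ 7 * weight (S n) * sum_n weight_term n /\
    cf_rec coef_a coef_b 0 1 (S (S n)) =
      INR (fact (S (S n))) ^ 7 * weight (S (S n)) * sum_n weight_term (S n))
    by apply H.
  induction n as [|n [IH0 IH1]].
  - rewrite sum_n_Rplus, !sum_O.
    rewrite cf_rec_SS, !INR_fact_S.
    unfold coef_a, coef_b, weight_term, weight; rewrite !S_INR; simpl.
    split; field.
  - split; [exact IH1|].
    rewrite cf_rec_SS, IH0, IH1, (sum_n_Rplus _ (S n)), (sum_n_Rplus _ n).
    rewrite !INR_fact_S.
    pose proof (weight_pos (S n)); pose proof (weight_pos (S (S n))).
    pose proof (weight_pos (S (S (S n)))).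
    (* With [t] for [weight_term], the coefficient of [s] vanishes by the recurrence of [A]; what
       remains is [b_(n+2) A_(n+1) t_(n+1) + A_(n+3) t_(n+2) = 0], a rational identity in [f] and
       [INR n]. *)
    generalize (sum_n weight_term n); intros s; generalize (INR (fact n)); intros f.
    unfold coef_a, coef_b, weight_term, weight in *.
    rewrite !S_INR in *; pose proof (pos_INR n).
    set (x := INR n) in *; field; repeat split; nra.
Qed.

(** A lower bound independent of [n] passes to the limit, which mere positivity of the partial sums
    would not do strictly. *)
Lemma sum_weight_term_ge (n : nat) : weight_term 0 <= sum_n weight_term n.
Proof.
  induction n as [|n IH].
  - rewrite sum_O; apply Rle_refl.
  - rewrite sum_n_Rplus.
    enough (0 < weight_term (S n)) by lra.
    apply Rinv_0_lt_compat, Rmult_lt_0_compat.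
    + apply pow_lt, lt_0_INR; lia.
    + apply Rmult_lt_0_compat; apply weight_pos.
Qed.

Lemma weight_term_0_pos : 0 < weight_term 0.
Proof.
  unfold weight_term, weight; simpl; apply Rinv_0_lt_compat; lra.
Qed.

Theorem theorem3p7 :
  is_CF
    (fun n : nat =>
       INR n ^ 7 + (INR n + 1) ^ 7
       + 8 * (INR n ^ 5 + (INR n + 1) ^ 5)
       - 8 * (INR n ^ 3 + (INR n + 1) ^ 3)
       + 4 * (2 * INR n + 1))
    (fun n : nat => - INR n ^ 14)
    (1 / (zeta 7 - 4 * zeta 3 + 4)).
Proof.
  change (is_CF coef_a coef_b (1 / (zeta 7 - 4 * zeta 3 + 4))).
  assert (Hlim : is_lim_seq (sum_n weight_term) (zeta 7 - 4 * zeta 3 + 4))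
    by exact is_series_weight_term.
  assert (Hs : forall n, 0 < sum_n weight_term n).
  { intros n; apply Rlt_le_trans with (1 := weight_term_0_pos).
    apply sum_weight_term_ge. }
  assert (Hfw : forall n, INR (fact n) ^ 7 * weight n <> 0).
  { intros n; apply Rmult_integral_contrapositive; split.
    - apply pow_nonzero, INR_fact_neq_0.
    - apply Rgt_not_eq, weight_pos. }
  split.
  - exists 1%nat; intros [|n] Hn; [lia|].
    rewrite cf_den_closed; apply Rmult_integral_contrapositive; split.
    + apply Hfw.
    + apply Rgt_not_eq, Hs.
  (* From index 1 on, [A_n] cancels and the convergent is the reciprocal of a partial sum. *)
  - apply is_lim_seq_incr_1.
    apply (is_lim_seq_ext (fun n => 1 / sum_n weight_term n)).
    + intros n; rewrite cf_num_closed, cf_den_closed.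
      pose proof (Hs n); pose proof (Hfw (S n)) as HS.
      set (c := INR (fact (S n)) ^ 7 * weight (S n)) in *.
      field; split; lra.
    + apply is_lim_seq_div'.
      * apply is_lim_seq_const.
      * exact Hlim.
      (* The limit is at least [weight_term 0 > 0], so dividing by it is legitimate. *)
      * pose proof (is_lim_seq_le _ _ _ _ sum_weight_term_ge
          (is_lim_seq_const (weight_term 0)) Hlim) as Hle.
        simpl in Hle; pose proof weight_term_0_pos; lra.
Qed.
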